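(* Let $N\ge 1$ be an integer, let $f:[0,\infty)\to\mathbb{R}$ be continuous, and let $\mathcal{A}(t)=A^{[0]}+f(t)A^{[1]}$ with the $(N+1)\times(N+1)$ matrices $A^{[0]},A^{[1]}$ given in the context. Let $\Omega(t)=\sum_{m=0}^\infty\sum_{\tau\in\mathbb{T}_m}\alpha(\tau)\int_0^t G_\tau(x)\,dx$ be the Magnus expansion of the linear ODE $p'=\mathcal{A}(t)p$ (defined in the context), considered for $t\ge 0$ for which the series over $m$ converges. Then $$\Omega(t)=tA^{[0]}+\sigma(t)A^{[1]},$$ where $$\sigma(t)=\int_0^t f(x)\,dx+\sum_{m=1}^\infty\sum_{\tau\in\mathbb{T}_m}\alpha(\tau)\int_0^t\sigma_\tau(x)\,dx,$$ and the scalar functions $\sigma_\tau$, for $\tau\in\mathbb{T}_m$, $m\ge1$, are defined recursively, writing $\tau=(\tau_1,\tau_2)$ with $\tau_1\in\mathbb{T}_{m_1}$, $\tau_2\in\mathbb{T}_{m_2}$, $m_1+m_2=m-1$, by: (i) if $m_1=m_2=0$, then $\sigma_\tau(t)=-2\int_0^t[f(t)-f(x)]\,dx$; (ii) if $m_1,m_2\ge1$, then $\sigma_\tau\equiv0$; (iii) if $m_1=0$ and $m_2=m-1\ge1$, then $\sigma_\tau(t)=-2t\,\sigma_{\tau_2}(t)$; (iv) if $m_1=m-1\ge1$ and $m_2=0$, then $\sigma_\tau(t)=2\int_0^t\sigma_{\tau_1}(x)\,dx$.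
   Context: Matrices are indexed by $k,\ell\in\{0,\ldots,N\}$. The only possibly nonzero entries of $A^{[0]}$ are $A^{[0]}_{\ell,\ell}=-N$, $A^{[0]}_{\ell-1,\ell}=\ell$, $A^{[0]}_{\ell+1,\ell}=N-\ell$; the only possibly nonzero entries of $A^{[1]}$ are $A^{[1]}_{\ell,\ell}=N-2\ell$, $A^{[1]}_{\ell-1,\ell}=\ell$, $A^{[1]}_{\ell+1,\ell}=-N+\ell$. The commutator is $[A,B]=AB-BA$. Magnus trees: $\mathbb{T}_0=\{\bullet\}$, and for $m\ge1$, $\mathbb{T}_m$ is the (finite) set of ordered pairs $\tau=(\tau_1,\tau_2)$ with $\tau_1\in\mathbb{T}_{m_1}$, $\tau_2\in\mathbb{T}_{m_2}$, $m_1+m_2=m-1$. Matrix-valued functions: $G_\bullet(t)=\mathcal{A}(t)$ and $G_{(\tau_1,\tau_2)}(t)=\left[\int_0^tG_{\tau_1}(x)\,dx,\;G_{\tau_2}(t)\right]$. Coefficients: $\alpha(\bullet)=1$; every $\tau\in\mathbb{T}_m$ with $m\ge1$ can be written uniquely as $\tau=(\eta_1,(\eta_2,(\cdots(\eta_s,\bullet)\cdots)))$ with $s\ge1$ and Magnus trees $\eta_1,\ldots,\eta_s$, and then $\alpha(\tau)=\frac{B_s}{s!}\prod_{j=1}^s\alpha(\eta_j)$, where $B_s$ are the Bernoulli numbers with $B_1=-\tfrac12$. The Magnus expansion is $\Omega(t)=\sum_{m=0}^\infty\sum_{\tau\in\mathbb{T}_m}\alpha(\tau)\int_0^tG_\tau(x)\,dx$;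 the series is understood for those $t$ for which it converges (in particular for small $t$). *)

(* Defs.v *)
From HB Require Import structures.
From mathcomp Require Import all_boot all_order all_algebra.
From mathcomp Require Import all_classical all_reals all_analysis.

Set Implicit Arguments.
Unset Strict Implicit.
Unset Printing Implicit Defensive.

Import Order.TTheory GRing.Theory Num.Theory.
Import numFieldNormedType.Exports.

Local Open Scope classical_set_scope.
Local Open Scope ring_scope.

Section Bernoulli.
Variable R : realType.

(* [:: B_0; ...; B_n], from B_0 = 1 and
   \sum_(k < n.+2) 'C(n.+2, k) B_k = 0, so that B_1 = -1/2. *)
Fixpoint bernoulli_seq (n : nat) : seq R :=
  if n is n'.+1 then
    let s := bernoulli_seq n' in
    rcons s (- (n'.+2%:R^-1 * \sum_(k < n'.+1) 'C(n'.+2, k)%:R * s`_k))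
  else [:: 1].

Definition bernoulli (n : nat) : R := (bernoulli_seq n)`_n.

Lemma size_bernoulli_seq n : size (bernoulli_seq n) = n.+1.
Proof. by elim: n => //= n IHn; rewrite size_rcons IHn. Qed.

Lemma nth_bernoulli_seq n k : (k <= n)%N -> (bernoulli_seq n)`_k = bernoulli k.
Proof.
elim: n => [|n IHn]; first by rewrite leqn0 => /eqP ->.
rewrite leq_eqVlt => /predU1P[-> //|]; rewrite ltnS => le_kn.
by rewrite /= nth_rcons size_bernoulli_seq ltnS le_kn IHn.
Qed.

Lemma bernoulliS n :
  bernoulli n.+1 =
  - (n.+2%:R^-1 * \sum_(k < n.+1) 'C(n.+2, k)%:R * bernoulli k).
Proof.
rewrite {1}/bernoulli /= nth_rcons size_bernoulli_seq ltnn eqxx.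
congr (- (_ * _)); apply: eq_bigr => k _.
by rewrite nth_bernoulli_seq // -ltnS.
Qed.

End Bernoulli.

Inductive magnus_tree : Type :=
| leaf : magnus_tree
| node : magnus_tree -> magnus_tree -> magnus_tree.

HB.instance Definition _ := gen_eqMixin magnus_tree.
HB.instance Definition _ := gen_choiceMixin magnus_tree.

Inductive in_magnus_trees : nat -> magnus_tree -> Prop :=
| in_leaf : in_magnus_trees 0 leaf
| in_node m1 m2 t1 t2 : in_magnus_trees m1 t1 -> in_magnus_trees m2 t2 ->
    in_magnus_trees (m1 + m2).+1 (node t1 t2).

Definition magnus_trees (m : nat) : set magnus_tree :=
  [set tau | in_magnus_trees m tau].

Lemma magnus_trees0 : magnus_trees 0 = [set leaf].
Proof.
apply/seteqP; split=> [tau|_ ->]; last exact: in_leaf.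
by rewrite /magnus_trees /= => Htau; inversion Htau.
Qed.

Lemma magnus_treesS m : magnus_trees m.+1 =
  \bigcup_(i in [set i | (i < m.+1)%N])
    ((fun p => node p.1 p.2) @` (magnus_trees i `*` magnus_trees (m - i))).
Proof.
apply/seteqP; split=> [tau Htau|tau [i]].
  inversion Htau as [|m1 m2 t1 t2 H1 H2 Hm Ht].
  exists m1; first by rewrite /= ltnS leq_addr.
  by exists (t1, t2) => //; split; rewrite //= addKn.
rewrite /= ltnS => le_im [[t1 t2] [/= H1 H2] <-].
by have := in_node H1 H2; rewrite subnKC.
Qed.

(* Guarantees that the sums \sum_(tau \in magnus_trees m) are genuine. *)
Lemma finite_magnus_trees m : finite_set (magnus_trees m).
Proof.
elim/ltn_ind: m => -[|m] IH; first by rewrite magnus_trees0; exact: finite_set1.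
rewrite magnus_treesS; apply: bigcup_finite; first exact: finite_II.
move=> i /= lt_im; apply/finite_image/finite_setX; first exact: IH.
by apply: IH; rewrite ltnS leq_subr.
Qed.

Section Alpha.
Variable R : realType.

(* [s] counts the left subtrees eta_1, ..., eta_s already split off;
   B_0 / 0! = 1 gives alpha leaf = 1. *)
Fixpoint alpha_rec (s : nat) (tau : magnus_tree) : R :=
  match tau with
  | leaf => bernoulli R s / s`!%:R
  | node eta tau' => alpha_rec 0 eta * alpha_rec s.+1 tau'
  end.

Definition alpha (tau : magnus_tree) : R := alpha_rec 0 tau.

Lemma alpha_leaf : alpha leaf = 1.
Proof. by rewrite /alpha /= /bernoulli /= fact0 divr1. Qed.

Lemma alpha_spine (etas : seq magnus_tree) :
  alpha (foldr node leaf etas) =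
  bernoulli R (size etas) / (size etas)`!%:R * \prod_(eta <- etas) alpha eta.
Proof.
suff H s : alpha_rec s (foldr node leaf etas) =
    bernoulli R (s + size etas) / (s + size etas)`!%:R *
    \prod_(eta <- etas) alpha eta by exact: H.
elim: etas s => [|eta etas IH] s /=; first by rewrite big_nil addn0 mulr1.
by rewrite IH big_cons addSnnS mulrCA.
Qed.

End Alpha.

Section Magnus.
Variables (R : realType) (N : nat).

Definition A0 : 'M[R]_N.+1 :=
  \matrix_(k, l)
    if k == l :> nat then - N%:R
    else if k.+1 == l :> nat then l%:R
    else if k == l.+1 :> nat then N%:R - l%:R
    else 0.

Definition A1 : 'M[R]_N.+1 :=
  \matrix_(k, l)
    if k == l :> nat then N%:R - 2 * l%:R
    else if k.+1 == l :> nat then l%:R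
    else if k == l.+1 :> nat then - N%:R + l%:R
    else 0.

Definition commutator (A B : 'M[R]_N.+1) : 'M[R]_N.+1 := A *m B - B *m A.

(* Meaningful for t >= 0 only; `[0, t] is empty for t < 0. *)
Definition int0 (g : R -> R) (t : R) : R :=
  \int[lebesgue_measure]_(x in `[0, t]) g x.

Definition mxint0 (F : R -> 'M[R]_N.+1) (t : R) : 'M[R]_N.+1 :=
  \matrix_(i, j) int0 (fun x => F x i j) t.

Variable f : R -> R.

Definition calA (t : R) : 'M[R]_N.+1 := A0 + f t *: A1.

Fixpoint G (tau : magnus_tree) (t : R) : 'M[R]_N.+1 :=
  match tau with
  | leaf => calA t
  | node tau1 tau2 => commutator (mxint0 (G tau1) t) (G tau2 t)
  end.

Definition Omega_term (t : R) (m : nat) : 'M[R]_N.+1 :=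
  \sum_(tau \in magnus_trees m) alpha R tau *: mxint0 (G tau) t.

Definition Omega (t : R) : 'M[R]_N.+1 :=
  limn (fun n : nat => \sum_(0 <= m < n) Omega_term t m).

(* A tree lies in magnus_trees 0 iff it is [leaf], whence the case analysis on
   the two subtrees. The value at [leaf] is a dummy. *)
Fixpoint sigma_tree (tau : magnus_tree) (t : R) : R :=
  match tau with
  | leaf => 0
  | node leaf leaf => - 2 * int0 (fun x => f t - f x) t
  | node (node _ _) (node _ _) => 0
  | node leaf (node _ _ as tau2) => - 2 * t * sigma_tree tau2 t
  | node (node _ _ as tau1) leaf => 2 * int0 (sigma_tree tau1) t
  end.

Definition sigma_term (t : R) (m : nat) : R :=
  \sum_(tau \in magnus_trees m) alpha R tau * int0 (sigma_tree tau) t.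

Definition sigma (t : R) : R :=
  int0 f t + limn (fun n : nat => \sum_(1 <= m < n) sigma_term t m).

End Magnus.

(* Main.v *)
(* Since [A0, A1] = -2 A1, commutators of combinations of A0 and A1 are multiples
   of A1. By induction on trees every G_tau with tau <> leaf is therefore
   sigma_tau A1, with sigma_tau obeying the stated recursion. A diagonal entry of
   A1 is N <> 0, so the matrix series converges only if the scalar one does. *)
Require Import Defs.
From HB Require Import structures.
From mathcomp Require Import all_boot all_order all_algebra.
From mathcomp Require Import all_classical all_reals all_analysis.
From mathcomp Require Import zify ring.

Import Order.TTheory GRing.Theory Num.Theory.
Import numFieldNormedType.Exports.

Local Open Scope classical_set_scope.
Local Open Scope ring_scope.

Ltac decide_nat_eqs := repeat match goal with |- context [@eq_op ?T ?a ?b] =>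
  first [rewrite (_ : @eq_op T a b = true); [|lia]
        |rewrite (_ : @eq_op T a b = false); [|lia]] end.

(** Meant for an entry in row [k] of a product with tridiagonal left factor. The last hypothesis
    lets the term at [k.+1] be written even for [k = N], where that index is out of range. *)
Lemma sum_ord_near (R : nmodType) (N k : nat) (F : nat -> R) : (k <= N)%N ->
    (forall j, (j.+1 < k)%N || (k.+1 < j)%N -> F j = 0) ->
    (k = N -> F k.+1 = 0) ->
  \sum_(j < N.+1) F j = (if k is k'.+1 then F k' else 0) + F k + F k.+1.
Proof.
move=> kN F0 FN.
(* The range is lengthened by [N.+1], whose term is zero, so that it always contains [k.+1]. *)
have -> : \sum_(j < N.+1) F j = \sum_(0 <= j < N.+2) F j.
  rewrite big_nat_recr //= big_mkord.
  have -> : F N.+1 = 0; last by rewrite addr0.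
  have [kEN|kNN] := eqVneq k N; first by rewrite -kEN FN.
  by apply: F0; lia.
rewrite (@big_cat_nat _ _ _ k) //=; last by lia.
rewrite (@big_cat_nat _ _ _ k.+2 k) //=; last by lia.
rewrite [X in _ + (_ + X)]big_nat_cond [X in _ + (_ + X)]big1 ?addr0; last first.
  by move=> j; rewrite andbT => Hj; apply: F0; lia.
rewrite big_nat_recr //= big_nat1 addrA; congr (_ + _ + _).
case: k kN F0 {FN} => [|k] kN F0; first by rewrite big_nil.
rewrite big_nat_recr //= big_nat_cond big1 ?add0r // => j.
by rewrite andbT => Hj; apply: F0; lia.
Qed.

Lemma commutator_A0_A1 (R : realType) (N : nat) :
  commutator (A0 R N) (A1 R N) = -2 *: A1 R N.
Proof.
pose a0 (k l : nat) : R := if k == l then - N%:R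
  else if k.+1 == l then l%:R else if k == l.+1 then N%:R - l%:R else 0.
pose a1 (k l : nat) : R := if k == l then N%:R - 2 * l%:R
  else if k.+1 == l then l%:R else if k == l.+1 then - N%:R + l%:R else 0.
pose F (k l j : nat) := a0 k j * a1 j l - a1 k j * a0 j l.
apply/matrixP => k l; rewrite !mxE -sumrB.
transitivity (\sum_(j < N.+1) F k l j).
  by apply: eq_bigr => j _; rewrite !mxE.
rewrite -/(a1 k l); move: (nat_of_ord k) (nat_of_ord l) (ltn_ord k) (ltn_ord l).
move=> {}k {}l kN lN.
rewrite (@sum_ord_near _ _ k) //; last 2 first.
- by move=> j Hj; rewrite /F /a0 /a1; decide_nat_eqs; rewrite !mul0r subrr.
- (* The formulas for the entries of A0 and A1, read at row N+1 and a column
     l <= N, give 0, so row k = N needs no separate treatment. *)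
  move=> kE; rewrite /F /a0 /a1.
  have [lE|lE] := eqVneq l N; last by decide_nat_eqs; rewrite !mulr0 subrr.
  by subst k l; decide_nat_eqs; ring.
rewrite /F /a0 /a1.
(* Row 0 is treated apart because it has no neighbour [j = k - 1]. *)
case: k kN => [|k] kN.
  have [l0|[l1|[l2|l3]]] : l = 0%N \/ l = 1%N \/ l = 2%N \/ (2 < l)%N by lia.
  - by subst l; rewrite /=; ring.
  - by subst l; rewrite /=; ring.
  - by subst l; rewrite /=; ring.
  - by decide_nat_eqs; ring.
(* A product of two tridiagonal matrices has bandwidth two: five diagonals around row [k.+1] are
   checked, and beyond them both sides vanish. *)
have [l0|[l1|[l2|[l3|[l4|l5]]]]] : l = k.+3 \/ l = k.+2 \/ l = k.+1 \/ l = k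
    \/ l.+1 = k \/ (l.+1 < k)%N || (k.+3 < l)%N by lia.
- by subst l; decide_nat_eqs; ring.
- by subst l; decide_nat_eqs; ring.
- by subst l; decide_nat_eqs; ring.
- by subst l; decide_nat_eqs; ring.
- by subst k; decide_nat_eqs; ring.
- by decide_nat_eqs; ring.
Qed.

Lemma commutator_lincomb (R : realType) (N : nat) (a b c d : R) :
  commutator (a *: A0 R N + b *: A1 R N) (c *: A0 R N + d *: A1 R N) =
  (2 * (b * c - a * d)) *: A1 R N.
Proof.
have := commutator_A0_A1 R N; rewrite /commutator.
rewrite !mulmxDl !mulmxDr -!scalemxAl -!scalemxAr !scalerA => /eqP.
(* [A0 *m A1] becomes [-2 *: A1 + A1 *m A0]; the remaining products cancel entrywise. *)
rewrite subr_eq => /eqP ->.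
by apply/matrixP => i j; rewrite !mxE; ring.
Qed.

Section int0.
Context {R : realType}.
Implicit Types (g h : R -> R) (T t : R).

Lemma integrable_continuous0 g T : {within `[0, T], continuous g} ->
  lebesgue_measure.-integrable `[0, T] (EFin \o g).
Proof.
by move=> cg; apply: continuous_compact_integrable => //; exact: segment_compact.
Qed.

Lemma within_continuous_int0 g T : 0 <= T -> {within `[0, T], continuous g} ->
  {within `[0, T], continuous (int0 g)}.
Proof.
by move=> T0 /integrable_continuous0; exact: parameterized_integral_continuous.
Qed.

Lemma int0_cst t (c : R) : 0 <= t -> int0 (fun=> c) t = c * t.
Proof.
move=> t0; rewrite /int0 Rintegral_cst //= lebesgue_measure_itv /= lte_fin.
by case: ltgtP t0 => // [_|<-] _; rewrite /= ?subr0.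
Qed.

(** Shaped for one entry of a combination of [A0] and [A1], with [b] and [d] the matrix entries. *)
Lemma int0_affine t (a b c d : R) g : 0 <= t ->
  {within `[0, t], continuous g} ->
  int0 (fun x => a * b + g x * d) t = a * t * b + int0 g t * d.
Proof.
move=> t0 cg.
have ig := integrable_continuous0 _ _ cg.
rewrite /int0 RintegralD //; last 2 first.
- apply: integrable_continuous0; exact: cst_continuous.
- apply: integrable_continuous0 => x; apply: cvgMr_tmp; exact: cg.
congr (_ + _); last exact: RintegralZr.
by rewrite mulrAC; exact: int0_cst.
Qed.

End int0.

(** The coefficient of [A0] in [G tau]. *)
Definition leaf_coef (R : realType) (tau : magnus_tree) : R :=
  if tau is leaf then 1 else 0.

(** The coefficient of [A1] in [G tau]: at [leaf] it is [f], in place of the dummy value of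
    [sigma_tree]. *)
Definition A1_coef {R : realType} (f : R -> R) (tau : magnus_tree) : R -> R :=
  if tau is leaf then f else sigma_tree f tau.

(** The four cases of the recursion merge into the coefficient given by [commutator_lincomb],
    because [leaf_coef] is 1 or 0 on each subtree. *)
Lemma A1_coef_node (R : realType) (f : R -> R) (tau1 tau2 : magnus_tree) (t : R) :
  0 <= t -> {within `[0, t], continuous f} ->
  A1_coef f (node tau1 tau2) t =
  2 * (int0 (A1_coef f tau1) t * leaf_coef R tau2
       - leaf_coef R tau1 * t * A1_coef f tau2 t).
Proof.
move=> t0 cf; case: tau1 tau2 => [|u1 u2] [|v1 v2] /=; try by ring.
(* Only two leaves remain; [f t] is constant in the integration variable. *)
rewrite (_ : (fun x => f t - f x) = (fun x => f t * 1 + f x * -1)); last first.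
  by apply/funext => x; ring.
by rewrite int0_affine //; ring.
Qed.

Lemma within_continuous_A1_coef (R : realType) (f : R -> R) (tau : magnus_tree)
    (T : R) : 0 <= T -> {within `[0, T], continuous f} ->
  {within `[0, T], continuous (A1_coef f tau)}.
Proof.
move=> T0 cf; elim: tau => [//|tau1 IH1 tau2 IH2].
(* The node formula is available only on [[0, T]], hence an equality on the subspace. *)
apply: (@subspace_eq_continuous _ _ _ (fun t =>
  2 * (int0 (A1_coef f tau1) t * leaf_coef R tau2
       - leaf_coef R tau1 * t * A1_coef f tau2 t))).
  move=> t tT; have /andP[t0 tleT] : 0 <= t <= T by move: tT; rewrite inE /= in_itv.
  apply/esym/A1_coef_node => //; apply: continuous_subspaceW cf.
  by apply: subset_itvl; rewrite bnd_simp.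
move=> t; apply: cvgMl_tmp; apply: cvgB.
  by apply: cvgMr_tmp; exact: within_continuous_int0.
apply: cvgM; last exact: IH2.
by apply: cvgMl_tmp; apply: continuous_subspaceT => x; exact: cvg_id.
Qed.

Lemma mxint0_lincomb (R : realType) (N : nat) (b t : R) (g : R -> R)
    (F : R -> 'M[R]_N.+1) : 0 <= t -> {within `[0, t], continuous g} ->
  (forall x, 0 <= x <= t -> F x = b *: A0 R N + g x *: A1 R N) ->
  mxint0 F t = (b * t) *: A0 R N + int0 g t *: A1 R N.
Proof.
move=> t0 cg FE; apply/matrixP => i j; rewrite mxE.
transitivity (int0 (fun x => b * A0 R N i j + g x * A1 R N i j) t).
  apply: eq_Rintegral => x.
  by rewrite inE /= in_itv /= => /FE ->; rewrite !mxE.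
by rewrite int0_affine // !mxE.
Qed.

Lemma G_lincomb (R : realType) (N : nat) (f : R -> R) (tau : magnus_tree) (t : R) :
  0 <= t -> {within `[0, t], continuous f} ->
  G N f tau t = leaf_coef R tau *: A0 R N + A1_coef f tau t *: A1 R N.
Proof.
(* [t] is generalized because the integral of [G tau1] needs the hypothesis at every [x] in
   [[0, t]]. *)
elim: tau t => [|tau1 IH1 tau2 IH2] t t0 cf; first by rewrite /= scale1r.
rewrite A1_coef_node // /= IH2 //.
rewrite (@mxint0_lincomb _ _ (leaf_coef R tau1) _ (A1_coef f tau1)) //.
- by rewrite commutator_lincomb scale0r add0r.
- exact: within_continuous_A1_coef.
- move=> x /andP[x0 xt]; apply: IH1 => //.
  by apply: continuous_subspaceW cf; apply: subset_itvl; rewrite bnd_simp.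
Qed.

Lemma mxint0_G (R : realType) (N : nat) (f : R -> R) (tau : magnus_tree) (t : R) :
  0 <= t -> {within `[0, t], continuous f} ->
  mxint0 (G N f tau) t =
  (leaf_coef R tau * t) *: A0 R N + int0 (A1_coef f tau) t *: A1 R N.
Proof.
move=> t0 cf; apply: mxint0_lincomb => //; first exact: within_continuous_A1_coef.
move=> x /andP[x0 xt]; apply: G_lincomb => //.
by apply: continuous_subspaceW cf; apply: subset_itvl; rewrite bnd_simp.
Qed.

Lemma Omega_term0 (R : realType) (N : nat) (f : R -> R) (t : R) :
  0 <= t -> {within `[0, t], continuous f} ->
  Omega_term N f t 0 = t *: A0 R N + int0 f t *: A1 R N.
Proof.
move=> t0 cf; rewrite /Omega_term magnus_trees0 fsbig_set1 alpha_leaf scale1r.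
by rewrite mxint0_G // mul1r.
Qed.

Lemma Omega_termS (R : realType) (N m : nat) (f : R -> R) (t : R) :
  0 <= t -> {within `[0, t], continuous f} ->
  Omega_term N f t m.+1 = sigma_term f t m.+1 *: A1 R N.
Proof.
move=> t0 cf; rewrite /Omega_term /sigma_term.
have finT := finite_magnus_trees m.+1.
rewrite !(fsbig_finite _ _ finT) /= scaler_suml.
apply: eq_big_seq => tau; rewrite in_fset_set // inE => tau_m.
rewrite mxint0_G // /leaf_coef /A1_coef.
(* A tree of positive order is not [leaf], so its [A0] part vanishes. *)
case: tau tau_m => [tau_m|tau1 tau2 _]; first by inversion tau_m.
by rewrite mul0r scale0r add0r scalerA.
Qed.

Theorem theorem1 (R : realType) (N : nat) (hN : (1 <= N)%N) (f : R -> R)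
  (hf : {within `[0, +oo[, continuous f}) (t : R) (ht : 0 <= t)
  (hcv : cvgn (fun n : nat => \sum_(0 <= m < n) Omega_term N f t m)) :
  cvgn (fun n : nat => \sum_(1 <= m < n) sigma_term f t m) /\
  Omega N f t = t *: A0 R N + sigma f t *: A1 R N.
Proof.
have cf : {within `[0, t], continuous f}.
  by apply: continuous_subspaceW hf; apply: subset_itvl.
pose s n := \sum_(1 <= m < n) sigma_term f t m.
pose S n := \sum_(0 <= m < n) Omega_term N f t m.
(* The index is [n.+1] because [S 0] is the empty sum and lacks the term of [leaf]. *)
have SE n : S n.+1 = t *: A0 R N + (int0 f t + s n.+1) *: A1 R N.
  rewrite /S /s big_ltn // Omega_term0 // scalerDl addrA; congr (_ + _).
  rewrite scaler_suml !big_add1 /=; apply: eq_bigr => m _.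
  exact: Omega_termS.
have N0 : N%:R != 0 :> R by rewrite pnatr_eq0 -lt0n.
(* Solves the [(0, 0)] entry of [SE], where [A0] has [- N] and [A1] has [N]. *)
have sE n : s n.+1 = ((S n.+1) ord0 ord0 + t * N%:R) / N%:R - int0 f t.
  by rewrite SE !mxE /= mulr0 subr0; field.
have cs : cvgn s.
  (* The witness is the right-hand side of [sE] at the limit of [S], as taking an entry is
     continuous. *)
  apply/cvg_ex; exists (((limn S) ord0 ord0 + t * N%:R) / N%:R - int0 f t).
  rewrite -cvg_shiftS; under eq_fun do rewrite sE.
  apply: cvgB; last exact: cvg_cst.
  apply: cvgMr_tmp; apply: cvgD; last exact: cvg_cst.
  have /= := @cvg_comp _ _ _ S (fun M : 'M[R]_N.+1 => M ord0 ord0) _ _ _ hcv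
    (@coord_continuous _ _ _ ord0 ord0 _).
  by rewrite -cvg_shiftS.
split=> //; rewrite /Omega; apply: cvg_lim; first exact: norm_hausdorff.
rewrite -cvg_shiftS; under eq_fun do rewrite -/(S _) SE.
apply: cvgD; first exact: cvg_cst.
apply: cvgZr_tmp; apply: cvgD; first exact: cvg_cst.
by rewrite (cvg_shiftS s).
Qed.
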